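(* Let $(G,\cdot)$ be a group such that $G/[G,G]\cong\mathbb{Z}$, and fix an abelianization map $\chi:G\to\mathbb{Z}$ (a surjective group morphism with kernel $[G,G]$). The two-sided skew brace structures $(G,\cdot,\bullet)$ on $(G,\cdot)$ with associative $\star$-product are exactly those given by \[a\bullet_z b=a\cdot b\cdot z^{\chi(a)\chi(b)},\qquad z\in Z(G)\cap[G,G].\] Each such structure has $P_3(G)=\{1\}$, and its parameter $z$ is unique. Moreover, the map \[F_z:(G,\cdot)\longrightarrow(G,\bullet_z),\quad g\longmapsto g\cdot z^{\binom{\chi(g)}{2}},\] is a group isomorphism, where $\binom{m}{2}=\frac{m(m-1)}{2}$ for $m\in\mathbb{Z}$. In particular, if $Z(G)\cap[G,G]=\{1\}$, the only such skew brace structure is the trivial one (i.e. $a\bullet b=a\cdot b$).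
   Context: A skew brace is a triple $(A,\cdot,\bullet)$ where $(A,\cdot)$ and $(A,\bullet)$ are groups with the same identity $1$ such that $a\bullet(b\cdot c)=(a\bullet b)\cdot a^{-1}\cdot(a\bullet c)$ for all $a,b,c\in A$, where $a^{-1}$ is the inverse in $(A,\cdot)$. It is two-sided if in addition $(a\cdot b)\bullet c=(a\bullet c)\cdot c^{-1}\cdot(b\bullet c)$ for all $a,b,c$. The $\star$-product is $a\star b:=a^{-1}\cdot(a\bullet b)\cdot b^{-1}$. For associative $\star$, $P_3(G)$ is the subgroup of $(G,\cdot)$ generated by all triple products $a\star b\star c$. $Z(G)$ and $[G,G]$ are the center and commutator subgroup of $(G,\cdot)$; powers of $z$ are taken in $(G,\cdot)$. *)

(* Defs.v *)
From mathcomp Require Import all_boot all_order all_algebra.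
From mathcomp Require Import boolp classical_sets.

Set Implicit Arguments.
Unset Strict Implicit.
Unset Printing Implicit Defensive.

Import GRing.Theory.

Local Open Scope classical_set_scope.
Local Open Scope group_scope.

(* Groups here may be infinite: [groupType] is the structure of mathcomp.boot's
   monoid.v, and subsets and subgroups are sets in the sense of
   mathcomp.classical, not finite sets. *)

Section Groups.
Variable G : groupType.

Definition is_subgroup (H : set G) : Prop :=
  [/\ H 1, forall x y, H x -> H y -> H (x * y) & forall x, H x -> H x^-1].

Definition generated (S : set G) : set G := smallest is_subgroup S.

Definition center : set G := [set z | forall x, commute z x].

Definition derived_subgroup : set G :=
  generated [set c | exists x y, c = [~ x, y]].

(* monoid.v only has powers with exponents in nat. *)
Definition expgz (x : G) (m : int) : G :=
  match m with Posz n => x ^+ n | Negz n => x ^- n.+1 end.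

(* int is an additive group in MathComp, so a group morphism from G to Z turns
   products into sums. *)
Definition is_abelianization_map (chi : G -> int) : Prop :=
  [/\ {morph chi : x y / x * y >-> (x + y)%R},
      forall m, exists g, chi g = m &
      [set g | chi g = 0%R] = derived_subgroup].

End Groups.

Arguments center : clear implicits.
Arguments derived_subgroup : clear implicits.

Definition is_group_law (T : Type) (e : T) (op : T -> T -> T) : Prop :=
  [/\ associative op, left_id e op, right_id e op &
      exists inv : T -> T, left_inverse e inv op /\ right_inverse e inv op].

Section SkewBraces.
Variable G : groupType.
Implicit Type op : G -> G -> G.

(* The first group operation of the skew brace is that of G; op is the second. *)
Definition is_skew_brace op : Prop :=
  is_group_law 1 op /\
  forall a b c, op a (b * c) = op a b * a^-1 * op a c.

Definition is_two_sided_skew_brace op : Prop :=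
  is_skew_brace op /\
  forall a b c, op (a * b) c = op a c * c^-1 * op b c.

Definition star op (a b : G) : G := a^-1 * op a b * b^-1.

(* Meant for associative [star op]; the bracketing is irrelevant only then. *)
Definition P3 op : set G :=
  generated [set t | exists a b c, t = star op (star op a b) c].

Definition is_assoc_two_sided_skew_brace op : Prop :=
  is_two_sided_skew_brace op /\ associative (star op).

Definition bullet (chi : G -> int) (z a b : G) : G :=
  a * b * expgz z (chi a * chi b)%R.

End SkewBraces.

(* The division is exact. *)
Definition binz2 (m : int) : int := ((m * (m - 1)) %/ 2)%Z.

Definition twist (G : groupType) (chi : G -> int) (z g : G) : G :=
  g * expgz z (binz2 (chi g)).

(* Main.v *)
Require Import Defs.
From HB Require Import structures.
From mathcomp Require Import all_boot all_order all_algebra.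
From mathcomp Require Import boolp classical_sets.
From mathcomp Require Import zify ring.

Set Implicit Arguments.
Unset Strict Implicit.
Unset Printing Implicit Defensive.

Import GRing.Theory.

Local Open Scope quotient_scope.
Local Open Scope classical_set_scope.
Local Open Scope group_scope.

(** Why the theorem holds. Write [a ⋆ b] for [star op a b], so that
    [op a b = a * (a ⋆ b) * b], and let C be the centraliser of all star values,
    a normal subgroup because conjugates of star values are products of star
    values and their inverses.

    Expanding [(a * b) ⋆ (c * d)] with the two distributive laws in both orders
    shows that, modulo C, [b ⋆ c] is the commutator b^-1 c b c^-1
    ([coset_star]). Associativity of the star product therefore makes this
    commutator operation of G / C associative, and by Levi's theorem
    ([opcomm_opcomm]) commutators are then central in G / C. As G is generated
    by [G, G] and one further element, G / C is abelian ([abelian_image]), hence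
    every star value is 1 modulo C: star values commute with one another.

    Once star values commute, associativity of [op] says exactly that
    [(a ⋆ (b ⋆ c)) * (a ⋆ c)] commutes with [b] ([triple_star_commute]). But
    this element is [a ⋆ ((b ⋆ c) * c)], and [c |-> (b ⋆ c) * c], which is
    [c |-> b^-1 * op b c], is onto because [op] is a group law. So all star
    values are central ([star_central]), the star product is a morphism in each
    argument, and it factors through [chi]:
    [a ⋆ b = z ^ (chi a * chi b)] with [z = g ⋆ g] for any [g] with [chi g = 1].

    That [z] is in [G, G] is a statement about Z = G / [G, G]: there [op]
    becomes (m, n) |-> m + n + k m n for an integer k, and the inverses of 1 and
    of -1 for this operation force 1 + k and 1 - k to be units, so k = 0
    ([chi_star]).

    Conversely, when [z] is central with [chi z = 0], the values of the star
    product are powers of [z], which [chi] kills; every axiom reduces to an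
    identity between exponents and all triple products are 1. The morphism
    property of [twist] is the identity
    (m + n choose 2) = (m choose 2) + (n choose 2) + m n. *)

(** * Quotient of a group by a normal subgroup *)

Definition is_normal_subgroup (G : groupType) (N : set G) : Prop :=
  is_subgroup N /\ forall x y, N x -> N (x ^ y).

Section Quotient.
Variables (G : groupType) (N : set G) (nN : is_normal_subgroup N).

Definition same_coset : rel G := fun x y => `[< N (x^-1 * y) >].

Lemma same_coset_refl : reflexive same_coset.
Proof. by move=> x; apply/asboolP; rewrite mulVg; case: nN.1. Qed.

Lemma same_coset_trans : transitive same_coset.
Proof.
move=> y x z /asboolP xy /asboolP yz; apply/asboolP.
by have [_ NM _] := nN.1; have := NM _ _ xy yz; rewrite !gnorm.
Qed.

Lemma same_coset_sym : symmetric same_coset.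
Proof.
have sym x y : same_coset x y -> same_coset y x.
  move=> /asboolP xy; apply/asboolP.
  by have [_ _ NV] := nN.1; have := NV _ xy; rewrite !gnorm.
by move=> x y; apply/idP/idP; apply: sym.
Qed.

Canonical same_coset_equiv :=
  EquivRel same_coset same_coset_refl same_coset_sym same_coset_trans.

Definition quotient_group := {eq_quot same_coset_equiv}.
HB.instance Definition _ := Choice.on quotient_group.

Definition coset_of (x : G) : quotient_group := \pi_{eq_quot same_coset_equiv} x.

Lemma coset_ofP x y : coset_of x = coset_of y <-> N (x^-1 * y).
Proof.
split; first by move=> /eqP; rewrite eqmodE => /asboolP.
by move=> xy; apply/eqP; rewrite eqmodE; apply/asboolP.
Qed.

Lemma coset_of_surj (q : quotient_group) : exists x, coset_of x = q.
Proof. by exists (repr q); rewrite /coset_of reprK. Qed.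

Definition quotient_mul (p q : quotient_group) := coset_of (repr p * repr q).
Definition quotient_inv (p : quotient_group) := coset_of (repr p)^-1.

(** The product of the chosen representatives lies in the coset of [x * y]
    because N is stable under conjugation. *)
Lemma coset_of_mul x y : quotient_mul (coset_of x) (coset_of y) = coset_of (x * y).
Proof.
have [_ NM _] := nN.1; apply/coset_ofP.
have reprN z : N ((repr (coset_of z))^-1 * z).
  by apply/coset_ofP; rewrite /coset_of reprK.
set x' := repr _; set y' := repr _.
have := NM _ _ (nN.2 _ y' (reprN x)) (reprN y).
by rewrite conjgE -/x' -/y' !gnorm.
Qed.

Lemma coset_of_inv x : quotient_inv (coset_of x) = coset_of x^-1.
Proof.
have [_ _ NV] := nN.1; apply/coset_ofP.
have : N ((repr (coset_of x))^-1 * x) by apply/coset_ofP; rewrite /coset_of reprK.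
move=> /NV /(nN.2 _ x^-1).
by rewrite conjgE !gnorm.
Qed.

Lemma quotient_mulgA : associative quotient_mul.
Proof.
move=> p q r; have [x <-] := coset_of_surj p; have [y <-] := coset_of_surj q.
by have [z <-] := coset_of_surj r; rewrite !coset_of_mul mulgA.
Qed.

Lemma quotient_mul1g : left_id (coset_of 1) quotient_mul.
Proof. by move=> p; have [x <-] := coset_of_surj p; rewrite coset_of_mul mul1g. Qed.

Lemma quotient_mulg1 : right_id (coset_of 1) quotient_mul.
Proof. by move=> p; have [x <-] := coset_of_surj p; rewrite coset_of_mul mulg1. Qed.

Lemma quotient_mulVg : left_inverse (coset_of 1) quotient_inv quotient_mul.
Proof.
by move=> p; have [x <-] := coset_of_surj p; rewrite coset_of_inv coset_of_mul mulVg.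
Qed.

Lemma quotient_mulgV : right_inverse (coset_of 1) quotient_inv quotient_mul.
Proof.
by move=> p; have [x <-] := coset_of_surj p; rewrite coset_of_inv coset_of_mul mulgV.
Qed.

HB.instance Definition _ := isGroup.Build quotient_group
  quotient_mulgA quotient_mul1g quotient_mulg1 quotient_mulVg quotient_mulgV.

Lemma coset_ofM x y : coset_of (x * y) = coset_of x * coset_of y.
Proof. by rewrite -coset_of_mul. Qed.

Lemma coset_ofV x : coset_of x^-1 = (coset_of x)^-1.
Proof. by rewrite -coset_of_inv. Qed.

Lemma coset_of_eq1 x : coset_of x = 1 <-> N x.
Proof.
have [_ _ NV] := nN.1.
rewrite [1](_ : _ = coset_of 1) // coset_ofP mulg1; split; last exact: NV.
by move=> /NV; rewrite invgK.
Qed.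

End Quotient.

(** * Groups whose commutator operation is associative *)

Lemma commuteJ (G : groupType) (z x y : G) : commute x y -> commute (x ^ z) (y ^ z).
Proof. by move=> xy; rewrite /commute -!conjMg xy. Qed.
Arguments commuteJ {G} z {x y}.

Lemma conjg_commute (G : groupType) (x y : G) : commute x y -> x ^ y = x.
Proof. by move=> xy; rewrite conjgE xy mulKg. Qed.

Section Levi.
Variable Q : groupType.
Implicit Types a b c x y : Q.

(** The commutator [[~ x, y^-1]]. It is the star product of the skew brace whose
    second law is the opposite of the first, which is why this variant of the
    commutator occurs below. *)
Definition opcomm (x y : Q) : Q := x^-1 * (y * x * y^-1).

Lemma opcommE x y : opcomm x y = x^-1 * x ^ y^-1.
Proof. by rewrite /opcomm conjgE invgK !mulgA. Qed.

Lemma opcomm_eq1 x y : opcomm x y = 1 <-> commute x y.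
Proof.
rewrite /opcomm; split => [e|<-]; last by rewrite !gnorm.
have := congr1 (fun t => x * t * y) e; rewrite !gnorm.
by [].
Qed.

Hypothesis opcommA : associative opcomm.

(** The next two lemmas are the 2-Engel identities: associativity turns a repeated
    adjacent argument into [opcomm x x = 1]. *)
Lemma opcomm_commuter x y : commute (opcomm x y) y.
Proof.
apply/opcomm_eq1; rewrite -opcommA.
have -> : opcomm y y = 1 by apply/opcomm_eq1.
by apply/opcomm_eq1; apply: commute1.
Qed.

Lemma opcomm_commutel x y : commute x (opcomm x y).
Proof.
apply/opcomm_eq1; rewrite opcommA.
have -> : opcomm x x = 1 by apply/opcomm_eq1.
by rewrite /opcomm !gnorm.
Qed.

(** Since [x] commutes with its commutators, it commutes with its conjugates: its
    normal closure is abelian. *)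
Lemma commute_conj x y z : commute (x ^ y) (x ^ z).
Proof.
have : commute x (x ^ (z * y^-1)).
  have := opcomm_commutel x (z * y^-1)^-1.
  rewrite opcommE invgK => e.
  rewrite -[_ ^ _](mulVKg x).
  by apply: commuteM.
by move=> /(commuteJ y); rewrite -conjgM mulgVK.
Qed.

Lemma commute_opcomm x y z : commute (opcomm x y) (opcomm x z).
Proof.
have cx u : commute x (x ^ u) by have := commute_conj x 1 u; rewrite conjg1.
rewrite !opcommE; apply: commuteM.
  by apply/commuteV/commute_sym/commuteM; [apply/commuteV|apply: cx].
apply/commute_sym/commuteM; last exact: commute_conj.
by apply/commuteV/commute_sym/cx.
Qed.

Lemma opcommVr x y : opcomm x y^-1 = (opcomm x y)^-1.
Proof.
rewrite -[in RHS](conjg_commute (opcomm_commuter x y)) !opcommE.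
by rewrite invgK conjMg conjVg conjgKV invgM invgK.
Qed.

(** Conjugation by [y * x^-1] carries the inverse of [opcomm x y] to [opcomm y x]
    and, by the Engel identities, fixes it. *)
Lemma opcommV x y : opcomm y x = (opcomm x y)^-1.
Proof.
have e : opcomm x y ^ (y * x^-1) = opcomm x y.
  rewrite conjgM (conjg_commute (opcomm_commuter x y)) conjg_commute //.
  exact/commuteV/commute_sym/opcomm_commutel.
by rewrite -[in RHS]e !opcommE !conjgE !gnorm.
Qed.

(** Levi's theorem: an associative commutator operation has central values.
    Write [t] for the double commutator. Inside the abelian normal closure of [a],
    the conjugates of [a], [opcomm a b] and [opcomm a c] by [b], [c] and their
    inverses are all expressible with [t], so conjugating [a] by the inverse of
    [opcomm b c] letter by letter gives [a * t * t], whereas by definition of [t]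
    it gives [a * t]. *)
Lemma opcomm_opcomm a b c : opcomm a (opcomm b c) = 1.
Proof.
set t := opcomm a (opcomm b c).
pose beta := opcomm a b; pose gamma := opcomm a c.
have tE : opcomm beta c = t by rewrite /t opcommA.
have tE' : opcomm gamma b = t^-1.
  by rewrite /gamma -opcommA (opcommV b c) opcommVr.
have tc : t ^ c = t.
  by rewrite -tE (conjg_commute (opcomm_commuter _ _)).
have tb : t ^ b = t.
  by rewrite -[t]invgK -tE' conjVg (conjg_commute (opcomm_commuter _ _)).
have bb : beta ^ b = beta by rewrite (conjg_commute (opcomm_commuter _ _)).
have cc : gamma ^ c = gamma by rewrite (conjg_commute (opcomm_commuter _ _)).
have ab : a ^ b = a * beta^-1.
  by rewrite -[in RHS]bb /beta opcommE conjMg conjVg conjgKV !gnorm.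
have ac : a ^ c = a * gamma^-1.
  by rewrite -[in RHS]cc /gamma opcommE conjMg conjVg conjgKV !gnorm.
have abV : a ^ b^-1 = a * beta by rewrite /beta opcommE mulVKg.
have acV : a ^ c^-1 = a * gamma by rewrite /gamma opcommE mulVKg.
have bcV : beta ^ c^-1 = beta * t by rewrite -tE opcommE mulVKg.
have cbV : gamma ^ b^-1 = gamma * t^-1 by rewrite -tE' opcommE mulVKg.
have tcV : t ^ c^-1 = t by rewrite -[in LHS]tc conjgK.
have ccV : gamma ^ c^-1 = gamma by rewrite -[in LHS]cc conjgK.
have cbt : commute beta t by apply: commute_opcomm.
have cgt : commute gamma t by apply: commute_opcomm.
have cgb : commute gamma beta by apply: commute_opcomm.
have tdef : t = a^-1 * (((a ^ c) ^ b^-1) ^ c^-1) ^ b.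
  by rewrite /t opcommE -!conjgM /opcomm !gnorm.
(* Opaque names keep the rewriting below from unfolding the commutators. *)
clearbody t beta gamma.
have tt : t = t * t.
  have e1 : (a ^ c) ^ b^-1 = a * beta * t * gamma^-1.
    by rewrite ac conjMg conjVg abV cbV invgM invgK !mulgA.
  have e2 : (a * beta * t * gamma^-1) ^ c^-1 = a * beta * t * t.
    have cg : commute gamma (beta * t * t) by do ?apply: commuteM.
    rewrite !conjMg conjVg acV bcV tcV ccV.
    transitivity (a * (gamma * (beta * t * t)) * gamma^-1); first by rewrite !mulgA.
    by rewrite cg !gnorm.
  have e3 : (a * beta * t * t) ^ b = a * t * t.
    by rewrite !conjMg ab bb tb !gnorm.
  by rewrite {1}tdef e1 e2 e3 !gnorm.
by apply: (mulgI t); rewrite -tt mulg1.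
Qed.
End Levi.

(** * Powers with integer exponents *)

Section IntPowers.
Variable G : groupType.
Implicit Types (x y : G) (m n : int).

Lemma expgzS x m : expgz x (m + 1)%R = expgz x m * x.
Proof.
case: m => n; first by rewrite addrC -intS /= expgSr.
case: n => [|n]; first by rewrite /= mulVg.
have -> : (Negz n.+1 + 1)%R = Negz n by rewrite !NegzE -[n.+2]addn1 PoszD opprD subrK.
by rewrite /expgz (expgS _ n.+1) invgM mulgVK.
Qed.

Lemma expgzB1 x m : expgz x (m - 1)%R = expgz x m * x^-1.
Proof. by rewrite -[m in RHS](subrK 1%R) expgzS mulgK. Qed.

Lemma expgzD x m n : expgz x (m + n)%R = expgz x m * expgz x n.
Proof.
elim/int_rect: n => [|n IH|n IH].
- by rewrite addr0 mulg1.
- by rewrite -addn1 PoszD addrA !expgzS IH mulgA.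
- by rewrite -addn1 PoszD opprD addrA !expgzB1 IH mulgA.
Qed.

Lemma expgzN x m : expgz x (- m)%R = (expgz x m)^-1.
Proof. by apply: (mulIg (expgz x m)); rewrite -expgzD addNr mulVg. Qed.

Lemma expgzM x m n : expgz x (m * n)%R = expgz (expgz x m) n.
Proof.
elim/int_rect: n => [|n IH|n IH]; first by rewrite mulr0.
- by rewrite -addn1 PoszD mulrDr mulr1 (expgzD x (m * _)) IH expgzS.
- by rewrite -addn1 PoszD opprD mulrDr mulrN1 (expgzD x (m * _)) expgzN IH expgzB1.
Qed.

Lemma subgroup_expgz (K : set G) x m : is_subgroup K -> K x -> K (expgz x m).
Proof.
move=> [K1 KM KV] Kx; elim/int_rect: m => [//|n IH|n IH].
- by rewrite -addn1 PoszD expgzS; apply: KM.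
- by rewrite -addn1 PoszD opprD expgzB1; apply/KM/KV.
Qed.

Lemma is_subgroup_center : is_subgroup (center G).
Proof.
split=> [x|x y Zx Zy z|x Zx y]; first exact/commute_sym/commute1.
  by apply/commute_sym/commuteM; apply: commute_sym.
exact/commute_sym/commuteV/commute_sym.
Qed.

End IntPowers.

(** * Groups with infinite cyclic abelianization *)

Lemma is_subgroup_preim_centraliser (G Q : groupType) (f : G -> Q) (q : Q) :
  {morph f : x y / x * y} -> is_subgroup [set x | commute (f x) q].
Proof.
move=> fM.
have f1 : f 1 = 1 by apply: (mulgI (f 1)); rewrite -fM !mulg1.
have fV x : f x^-1 = (f x)^-1 by apply: (mulgI (f x)); rewrite -fM !mulgV.
split=> [|x y /= fx fy|x /= fx].
- by rewrite /= f1; apply/commute_sym/commute1.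
- by rewrite fM; apply/commute_sym/commuteM; apply: commute_sym.
- by rewrite fV; apply/commute_sym/commuteV/commute_sym.
Qed.

Section CyclicAbelianization.
Variables (G : groupType) (chi : G -> int).
Hypothesis chi_ab : is_abelianization_map chi.
Implicit Types x y : G.

Let chiM x y : chi (x * y) = (chi x + chi y)%R.
Proof. by case: chi_ab. Qed.

Lemma chi1 : chi 1 = 0%R.
Proof. by apply: (addrI (chi 1)); rewrite -chiM mulg1 addr0. Qed.

Lemma chiV x : chi x^-1 = (- chi x)%R.
Proof. by apply: (addrI (chi x)); rewrite -chiM mulgV subrr chi1. Qed.

Lemma chi_expgz x m : chi (expgz x m) = (m * chi x)%R.
Proof.
elim/int_rect: m => [|n IH|n IH]; first by rewrite /= chi1 mul0r.
- by rewrite -addn1 PoszD expgzS chiM IH mulrDl mul1r.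
- by rewrite -addn1 PoszD opprD expgzB1 chiM chiV IH mulrDl mulN1r.
Qed.

Lemma derivedP x : derived_subgroup G x <-> chi x = 0%R.
Proof. by case: chi_ab => _ _ <-. Qed.

Lemma ex_generator : exists g, chi g = 1%R.
Proof. by case: chi_ab. Qed.

Lemma chi_conj x y : chi (x ^ y) = chi x.
Proof. by rewrite conjgE !chiM chiV addrCA addNr addr0. Qed.

Lemma chi_comm x y : chi [~ x, y] = 0%R.
Proof. by rewrite commgEl chiM chiV chi_conj addNr. Qed.

Lemma derived_least (K : set G) :
  is_subgroup K -> (forall x y, K [~ x, y]) -> forall x, chi x = 0%R -> K x.
Proof.
move=> sK Kcomm x /derivedP; apply: smallest_sub => //.
by move=> _ [a [b ->]].
Qed.

(** G is generated by its derived subgroup and any element [g] with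
    [chi g = 1]. *)
Lemma subgroup_full (K : set G) g :
  is_subgroup K -> chi g = 1%R -> K g ->
  (forall x, chi x = 0%R -> K x) -> forall x, K x.
Proof.
move=> sK g1 Kg Kder x; rewrite -[x](mulVKg (expgz g (chi x))).
have [_ KM _] := sK; apply: KM; first exact: subgroup_expgz.
by apply: Kder; rewrite chiM chiV chi_expgz g1 mulr1 addNr.
Qed.

(** A group whose quotient by a central subgroup is cyclic is abelian; here the
    central subgroup is the image of [G, G]. First [f g], then every [f y], is
    seen to be centralised by the image of [f]. *)
Lemma abelian_image (Q : groupType) (f : G -> Q) :
  {morph f : x y / x * y} ->
  (forall c x, chi c = 0%R -> commute (f c) (f x)) ->
  forall x y, commute (f x) (f y).
Proof.
move=> fM fder; have [g g1] := ex_generator.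
have fg x : commute (f x) (f g).
  apply: (subgroup_full (is_subgroup_preim_centraliser (f g) fM) g1) => //=.
  by move=> c; apply: fder.
move=> x y; apply: (subgroup_full (is_subgroup_preim_centraliser (f y) fM) g1).
  exact/commute_sym/fg.
by move=> c; apply: fder.
Qed.

Lemma derived_morph1 (f : G -> G) :
  {morph f : x y / x * y} -> (forall x y, commute (f x) (f y)) ->
  forall c, chi c = 0%R -> f c = 1.
Proof.
move=> fM fC.
have f1 : f 1 = 1 by apply: (mulgI (f 1)); rewrite -fM !mulg1.
have fV x : f x^-1 = (f x)^-1 by apply: (mulgI (f x)); rewrite -fM !mulgV.
apply: (@derived_least [set x | f x = 1]).
  split=> [|x y /= fx fy|x /= fx]; first exact: f1.
    by rewrite fM fx fy mulg1.
  by rewrite fV fx invg1.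
move=> x y /=; rewrite !fM !fV; exact/eqP/commgP.
Qed.

Lemma morph_expgz (f : G -> G) g :
  {morph f : x y / x * y} -> (forall x y, commute (f x) (f y)) ->
  chi g = 1%R -> forall x, f x = expgz (f g) (chi x).
Proof.
move=> fM fC g1.
have f1 : f 1 = 1 by apply: (mulgI (f 1)); rewrite -fM !mulg1.
have fV x : f x^-1 = (f x)^-1 by apply: (mulgI (f x)); rewrite -fM !mulgV.
apply: (@subgroup_full [set x | f x = expgz (f g) (chi x)] g) => //=.
- split=> [|x y /= fx fy|x /= fx]; first by rewrite /= chi1 f1.
    by rewrite fM chiM expgzD -fx -fy.
  by rewrite fV chiV expgzN fx.
- by rewrite g1.
by move=> x x0; rewrite x0 (derived_morph1 fM fC).
Qed.

Lemma additive_chi (f : G -> int) g :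
  {morph f : x y / x * y >-> (x + y)%R} -> chi g = 1%R ->
  forall x, f x = (chi x * f g)%R.
Proof.
move=> fM g1.
have f1 : f 1 = 0%R by apply: (addrI (f 1)); rewrite -fM mulg1 addr0.
have fV x : f x^-1 = (- f x)%R by apply: (addrI (f x)); rewrite -fM mulgV subrr f1.
have sK : is_subgroup [set x | f x = (chi x * f g)%R].
  split=> [|x y /= fx fy|x /= fx]; first by rewrite /= chi1 f1 mul0r.
    by rewrite fM chiM mulrDl fx fy.
  by rewrite fV chiV mulNr fx.
apply: (subgroup_full sK g1) => /=; first by rewrite g1 mul1r.
apply: (derived_least sK) => x y /=.
by rewrite chi_comm mul0r commgEl conjgE !fM !fV [(f x + f y)%R]addrC addKr addNr.
Qed.

End CyclicAbelianization.

(** * Skew braces are given by a central parameter *)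

Lemma int_mul_eq1 (m n : int) : (m * n = 1 -> m = 1 \/ m = -1)%R.
Proof.
move=> e; have : m \is a GRing.unit by apply/unitrP; exists n; rewrite mulrC e.
by move=> /pred2P[] ->; [left|right].
Qed.

Section SkewBrace.
Variables (G : groupType) (chi : G -> int).
Hypothesis chi_ab : is_abelianization_map chi.
Variable op : G -> G -> G.
Hypothesis op_brace : is_assoc_two_sided_skew_brace op.
Implicit Types a b c x y : G.

Local Notation "a ⋆ b" := (star op a b) (at level 40, left associativity).

Let chiM x y : chi (x * y) = (chi x + chi y)%R.
Proof. by case: chi_ab. Qed.

Let starA a b c : a ⋆ (b ⋆ c) = a ⋆ b ⋆ c.
Proof. exact: op_brace.2. Qed.

Lemma opE a b : op a b = a * (a ⋆ b) * b.
Proof. by rewrite /star !gnorm. Qed.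

(** Left distributivity makes [star op a] a crossed morphism; right
    distributivity does the same in the other argument. *)
Lemma starMr a b c : a ⋆ (b * c) = (a ⋆ b) * (a ⋆ c) ^ b^-1.
Proof.
have [[[_ ld] _] _] := op_brace.
by rewrite /star ld conjgE !gnorm.
Qed.

Lemma starMl a b c : (a * b) ⋆ c = (a ⋆ c) ^ b * (b ⋆ c).
Proof.
have [[_ rd] _] := op_brace.
by rewrite /star rd conjgE !gnorm.
Qed.

Definition star_centraliser : set G := [set x | forall a b, commute x (a ⋆ b)].
Local Notation C := star_centraliser.

Lemma starJ a b x : (a ⋆ b) ^ x = (a ⋆ x^-1)^-1 * (a ⋆ (x^-1 * b)).
Proof. by rewrite starMr invgK mulKg. Qed.

Lemma star_centraliser_normal : is_normal_subgroup C.
Proof.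
split.
  split=> [a b|x y Cx Cy a b|x Cx a b]; first exact/commute_sym/commute1.
    by apply/commute_sym/commuteM; apply: commute_sym.
  exact/commute_sym/commuteV/commute_sym.
move=> x y Cx a b; rewrite -[a ⋆ b](conjgKV y); apply: commuteJ.
by rewrite starJ; apply: commuteM => //; apply: commuteV.
Qed.

(** Both ways of expanding [(a * b) ⋆ (c * d)] begin with the conjugate of [a ⋆ c]
    and end with that of [b ⋆ d]; cancelling these leaves a commutation
    relation. *)
Lemma two_sided_centralises b c : C (c^-1 * op b c * b^-1).
Proof.
move=> a d.
have e : (a ⋆ c) ^ b * (b ⋆ c) * ((a ⋆ d) ^ b * (b ⋆ d)) ^ c^-1 =
         ((a ⋆ c) * (a ⋆ d) ^ c^-1) ^ b * ((b ⋆ c) * (b ⋆ d) ^ c^-1).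
  by rewrite -!starMl -!starMr -starMl.
rewrite opE /commute.
have := congr1 (fun t => c^-1 * (a ⋆ c)^-1 * b * t * c * (b ⋆ d)^-1 * b^-1) e.
by rewrite !conjgE !gnorm.
Qed.

Local Notation pi := (coset_of star_centraliser_normal).

(** Modulo C the second law is the opposite of the first. *)
Lemma coset_star b c : pi (b ⋆ c) = opcomm (pi b) (pi c).
Proof.
have /(coset_of_eq1 star_centraliser_normal) := two_sided_centralises b c.
rewrite opE !coset_ofM !coset_ofV => e.
have := congr1 (fun u => (pi b)^-1 * pi c * u * pi b * (pi c)^-1) e.
by rewrite /opcomm !gnorm.
Qed.

Lemma opcommA_coset : associative (@opcomm (quotient_group star_centraliser_normal)).
Proof.
move=> p q r; have [x <-] := coset_of_surj p; have [y <-] := coset_of_surj q.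
by have [z <-] := coset_of_surj r;
  rewrite -(coset_star y) -(coset_star x y) -!coset_star starA.
Qed.

Lemma commute_coset x y : commute (pi x) (pi y).
Proof.
have comm_central u v w : commute (pi [~ u, v]) (pi w).
  have -> : pi [~ u, v] = opcomm (pi u) (pi v^-1).
    by rewrite !coset_ofM !coset_ofV /opcomm !gnorm.
  exact/commute_sym/opcomm_eq1/opcomm_opcomm/opcommA_coset.
apply: (abelian_image chi_ab); first exact: coset_ofM.
move=> c z c0.
apply: (derived_least chi_ab
  (@is_subgroup_preim_centraliser _ _ pi (pi z) (coset_ofM _))) => //= u v.
Qed.

Lemma star_centralises a b : C (a ⋆ b).
Proof.
apply/(coset_of_eq1 star_centraliser_normal); rewrite coset_star.
exact/opcomm_eq1/commute_coset.
Qed.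

Lemma commute_star a b c d : commute (a ⋆ b) (c ⋆ d).
Proof. exact: star_centralises. Qed.

(** [chi (a ⋆ b)] is biadditive, hence [k * chi a * chi b] for a fixed [k], and
    [chi] carries [op] to (m, n) |-> m + n + k m n, which has inverses for all
    values of [chi] only when [k = 0]. *)
Lemma chi_star a b : chi (a ⋆ b) = 0%R.
Proof.
have [g g1] := ex_generator chi_ab.
pose k := chi (g ⋆ g).
have chiE x y : chi (x ⋆ y) = (chi x * chi y * k)%R.
  rewrite (additive_chi chi_ab (f := fun t => chi (t ⋆ y)) _ g1); last first.
    by move=> u v; rewrite starMl chiM (chi_conj chi_ab).
  rewrite (additive_chi chi_ab (f := fun t => chi (g ⋆ t)) _ g1) ?mulrA //.
  by move=> u v; rewrite starMr chiM (chi_conj chi_ab).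
have chi_op x y : chi (op x y) = (chi x + chi y + chi x * chi y * k)%R.
  by rewrite opE (chiM _ y) (chiM x) chiE addrAC.
have [[[[_ _ _ [inv [_ op_inv]]] _] _] _] := op_brace.
have eqn x : (chi x + chi (inv x) + chi x * chi (inv x) * k = 0)%R.
  by rewrite -chi_op op_inv (chi1 chi_ab).
have k0 : k = 0%R.
  have := eqn g; have := eqn g^-1; rewrite (chiV chi_ab) g1.
  move: (chi (inv g)) (chi (inv g^-1)) => n m e1 e2.
  clearbody k.
  (* [m] and [n] are the inverses of -1 and 1 for the induced law on integers. *)
  have e1' : ((1 - k) * m = 1)%R by lia.
  have e2' : ((1 + k) * - n = 1)%R by lia.
  by case: (int_mul_eq1 e1'); case: (int_mul_eq1 e2'); lia.
by rewrite chiE k0 mulr0.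
Qed.

(** This is what associativity of [op] amounts to once star values commute. *)
Lemma triple_star_commute a b c : commute ((a ⋆ (b ⋆ c)) * (a ⋆ c)) b.
Proof.
have [[[[opA _ _ _] _] _] _] := op_brace.
set u := b ⋆ c; set v := a ⋆ b; set w := a ⋆ c; set t := a ⋆ u.
have opl : op a (op b c) = a * v * t ^ b^-1 * w ^ b^-1 * b * u * c.
  rewrite !opE starMr starMr invgM conjgM -/u -/v -/w -/t.
  rewrite (conjg_commute (x := w)) ?mulgA //.
  exact/commuteV/commute_star.
have opr : op (op a b) c = a * v * b * w ^ b * t ^ b * u * c.
  rewrite !opE starMl starMl -/u -/v -/w -starA -/u -/t.
  by rewrite [w ^ v](conjg_commute (commute_star _ _ _ _)) conjMg !mulgA.
have := opA a b c; rewrite opl opr.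
have : commute t w by exact: commute_star.
clearbody t u v w => tw e.
have := congr1 (fun x => v^-1 * a^-1 * x * c^-1 * u^-1) e.
rewrite !conjgE !gnorm => e'.
by rewrite /commute mulgA e' tw.
Qed.

(** The map is [c |-> g^-1 * op g c], a bijection since [op] is a group law. *)
Lemma lambda_surj g y : exists c, (g ⋆ c) * c = y.
Proof.
have [[[[opA op1 _ [inv [_ opV]]] _] _] _] := op_brace.
exists (op (inv g) (g * y)).
by apply: (mulgI g); rewrite mulgA -opE opA opV op1.
Qed.

(** Writing [b] as [(x ⋆ c) * c] turns [a ⋆ b] into the element that
    [triple_star_commute] shows to commute with [x]. *)
Lemma star_central a b x : commute (a ⋆ b) x.
Proof.
have [c <-] := lambda_surj x b.
rewrite starMr (conjg_commute (x := a ⋆ c)); first exact: triple_star_commute.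
exact/commuteV/commute_star.
Qed.

Lemma star_expgz g a b : chi g = 1%R -> a ⋆ b = expgz (g ⋆ g) (chi a * chi b)%R.
Proof.
move=> g1; have starJ_id x y z : (x ⋆ y) ^ z = x ⋆ y by exact/conjg_commute/star_central.
rewrite expgzM (morph_expgz chi_ab (f := star op a) _ _ g1) => [|x y|x y].
- congr expgz; apply: (morph_expgz chi_ab (f := fun x => x ⋆ g) _ _ g1) => x y.
    by rewrite starMl starJ_id.
  exact: star_central.
- by rewrite starMr starJ_id.
- exact: star_central.
Qed.

Lemma skew_brace_is_bullet : exists2 z,
  (center G `&` derived_subgroup G) z & op =2 bullet chi z.
Proof.
have [g g1] := ex_generator chi_ab; exists (g ⋆ g).
  by split; [exact: star_central | apply/(derivedP chi_ab)/chi_star].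
by move=> a b; rewrite /bullet -(star_expgz a b g1) opE -mulgA star_central mulgA.
Qed.

End SkewBrace.

(** * The structures attached to a parameter *)

Lemma binz2K m : (binz2 m * 2 = m * (m - 1))%R.
Proof.
rewrite /binz2 divzK //.
have /andP[r0 r2] : (0 <= (m %% 2)%Z < 2)%R by rewrite modz_ge0 // ltz_pmod.
rewrite {1 2}(divz_eq m 2); have [->|->] : (m %% 2)%Z = 0%R \/ (m %% 2)%Z = 1%R by lia.
  by rewrite addr0 -mulrA mulrCA dvdz_mulr.
by rewrite addrK !dvdz_mull.
Qed.

Section Bullet.
Variables (G : groupType) (chi : G -> int) (z : G).
Hypothesis chi_ab : is_abelianization_map chi.
Hypothesis z_central_derived : (center G `&` derived_subgroup G) z.
Implicit Types a b c : G.

Let chiM a b : chi (a * b) = (chi a + chi b)%R.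
Proof. by case: chi_ab. Qed.

Lemma expgz_commute m a : commute (expgz z m) a.
Proof. exact: (subgroup_expgz _ (is_subgroup_center G) z_central_derived.1). Qed.

Lemma chi_expgz_z m : chi (expgz z m) = 0%R.
Proof.
by rewrite (chi_expgz chi_ab) (derivedP chi_ab z).1 ?mulr0 //; case: z_central_derived.
Qed.

Lemma chi_mul_expgz a m : chi (a * expgz z m) = chi a.
Proof. by rewrite chiM chi_expgz_z addr0. Qed.

Lemma mul_expgz a b m n :
  (a * expgz z m) * (b * expgz z n) = a * b * expgz z (m + n)%R.
Proof. by rewrite -mulgA (mulgA _ b) expgz_commute expgzD !mulgA. Qed.

Lemma star_bullet a b : star (bullet chi z) a b = expgz z (chi a * chi b)%R.
Proof. by rewrite /star /bullet !mulgA mulVg mul1g -expgz_commute mulgK. Qed.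

Lemma bullet_law : is_group_law 1 (bullet chi z).
Proof.
have chi_bullet a b : chi (bullet chi z a b) = (chi a + chi b)%R.
  by rewrite /bullet chi_mul_expgz.
split=> [a b c|a|a|].
- rewrite {1}/bullet [RHS]/bullet !chi_bullet /bullet.
  have := mul_expgz (a * b) c (chi a * chi b)%R 0%R.
  rewrite mulg1 addr0 => ->.
  rewrite (mulgA a) -(mulgA _ (expgz _ _)) -expgzD.
  rewrite -(mulgA _ (expgz _ _)) -expgzD !mulgA; congr (_ * expgz _ _); ring.
- by rewrite /bullet (chi1 chi_ab) mul0r mul1g mulg1.
- by rewrite /bullet (chi1 chi_ab) mulr0 !mulg1.
exists (fun a => a^-1 * expgz z (chi a * chi a)%R); split=> a;
  rewrite /bullet chi_mul_expgz (chiV chi_ab).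
  by rewrite -(mulgA a^-1) expgz_commute mulKg -expgzD mulNr addrN.
by rewrite mulgA mulgV mul1g -expgzD mulrN addrN.
Qed.

Lemma bullet_brace : is_assoc_two_sided_skew_brace (bullet chi z).
Proof.
split; first split; first split; first exact: bullet_law.
- move=> a b c; rewrite /bullet chiM mulrDr expgzD.
  by rewrite !mulgA mulgVK -(mulgA (a * b) _ c) expgz_commute !mulgA.
- move=> a b c; rewrite /bullet chiM mulrDl expgzD.
  rewrite -(mulgA _ _ c^-1) (expgz_commute _ c^-1) !mulgA mulgK.
  rewrite -(mulgA a _ b) (expgz_commute _ b) mulgA.
  by rewrite -(mulgA _ _ c) (expgz_commute _ c) !mulgA.
by move=> a b c; rewrite !star_bullet !chi_expgz_z mulr0 mul0r.
Qed.

Lemma P3_bullet : P3 (bullet chi z) = [set 1].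
Proof.
apply/seteqP; split.
  apply: smallest_sub => /=.
    split=> [//|x y -> ->|x ->] /=; by rewrite ?mulg1 ?invg1.
  by move=> _ [a [b [c ->]]]; rewrite !star_bullet chi_expgz_z mul0r.
by move=> _ -> K [[]].
Qed.

Lemma twist_morph : {morph twist chi z : a b / a * b >-> bullet chi z a b}.
Proof.
move=> a b; rewrite /bullet /twist !chi_mul_expgz mul_expgz -(mulgA (a * b)).
rewrite -expgzD chiM; congr (_ * expgz _ _).
by have := binz2K (chi a); have := binz2K (chi b); have := binz2K (chi a + chi b)%R; nia.
Qed.

(** The inverse divides by the same power of [z], because [twist] preserves
    [chi]. *)
Lemma twist_bij : bijective (twist chi z).
Proof.
exists (fun a => a * (expgz z (binz2 (chi a)))^-1) => a; rewrite /twist.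
  by rewrite chi_mul_expgz mulgK.
by rewrite -expgzN chi_mul_expgz expgzN mulgVK.
Qed.

End Bullet.

Theorem proposition4p14 (G : groupType) (chi : G -> int)
    (chi_ab : is_abelianization_map chi) :
  [/\ (forall op : G -> G -> G,
         is_assoc_two_sided_skew_brace op <->
         exists2 z, (center G `&` derived_subgroup G) z & op =2 bullet chi z),
      (forall op : G -> G -> G,
         is_assoc_two_sided_skew_brace op -> P3 op = [set 1]),
      (forall z z' : G,
         (center G `&` derived_subgroup G) z ->
         (center G `&` derived_subgroup G) z' ->
         bullet chi z =2 bullet chi z' -> z = z'),
      (forall z : G, (center G `&` derived_subgroup G) z ->
         bijective (twist chi z) /\
         {morph twist chi z : a b / a * b >-> bullet chi z a b}) &
      (center G `&` derived_subgroup G = [set 1] ->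
       forall op : G -> G -> G,
         is_assoc_two_sided_skew_brace op <-> op =2 (fun a b => a * b))].
Proof.
have braceP op : is_assoc_two_sided_skew_brace op <->
    exists2 z, (center G `&` derived_subgroup G) z & op = bullet chi z.
  split=> [/(skew_brace_is_bullet chi_ab)[z zP opz]|[z zP ->]]; last exact: bullet_brace.
  by exists z => //; apply/funext => a; apply/funext => b.
split=> [op|op /braceP[z zP ->]|z z' _ _ zz'|z zP|Z1 op].
- split=> [/(skew_brace_is_bullet chi_ab)//|[z zP opz]]; apply/braceP; exists z => //.
  by apply/funext => a; apply/funext => b.
- exact: P3_bullet.
- have [g g1] := ex_generator chi_ab.
  by have := zz' g g; rewrite /bullet g1 => /mulgI.
- by split; [exact: twist_bij|exact: twist_morph].
have bullet1 : bullet chi 1 = (fun a b => a * b).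
  apply/funext => a; apply/funext => b; rewrite /bullet.
  have -> : expgz 1 (chi a * chi b) = 1 :> G.
    by case: (chi a * chi b)%R => n /=; rewrite expg1n ?invg1.
  exact: mulg1.
rewrite braceP Z1 -bullet1; split=> [[z -> ->] //|op1]; exists 1 => //.
by apply/funext => a; apply/funext => b.
Qed.
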